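(* Let $X$ and $Y$ be real normed spaces, and let $f: X \rightarrow Y$ be a surjective phase-isometry satisfying the following conditions: (a) for every $x\in X$ with $\|x\|=1$ and every $t>0$, $f(t x)=tf(x)$ or $f(tx)=-tf(x)$; (b) there exist a vector $x_0\in X$ with $\|x_0\|=1$ and a hyperplane $Z\subset X$ through the origin such that $x_0\bot Z$ and $Z\bot x_0$; moreover, for every $z\in Z$ there exist two real numbers $\alpha(z)$ and $\beta(z)$ with $|\alpha(z)|=|\beta(z)|=1$ such that $f(z+x_0)=\alpha(z) f(z)+\beta(z) f(x_0)$. Then $f$ is phase equivalent to a linear isometry.
   Context: A mapping $f: X\to Y$ between real normed spaces is a phase-isometry if $\{\|f(x)+f(y)\|, \|f(x)-f(y)\|\}=\{\|x+y\|, \|x-y\|\}$ (equality of unordered pairs) for all $x,y\in X$. No continuity or linearity is assumed. A mapping $f:X\to Y$ is phase equivalent to a linear isometry if there exists a function $\varepsilon: X\to\{-1,1\}$ such that the map $x\mapsto \varepsilon(x)f(x)$ is a linear isometry. For $x,y\in X$, $x\bot y$ denotes Birkhoff orthogonality: $\|x+ty\|\geq\|x\|$ for all $t\in\mathbb{R}$ (this relation need not be symmetric). For a subset $A\subset X$, $x\bot A$ means $x\bot z$ for every $z\in A$, and $A\bot x$ means $z\bot x$ for every $z\in A$. A hyperplane through the origin is a linear subspace of codimension one. *)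

(* Defs.v *)
From HB Require Import structures.
From mathcomp Require Import all_boot all_order all_algebra.
From mathcomp Require Import all_classical reals topology normedtype.

Set Implicit Arguments.
Unset Strict Implicit.
Unset Printing Implicit Defensive.

Import Order.TTheory GRing.Theory Num.Theory.
Import numFieldNormedType.Exports.

Local Open Scope classical_set_scope.
Local Open Scope ring_scope.

Definition phase_isometry (R : realType) (X Y : normedModType R) (f : X -> Y) : Prop :=
  forall x y : X,
    [set `|f x + f y|; `|f x - f y|] = [set `|x + y|; `|x - y|] :> set R.

Definition linear_isometry (R : realType) (X Y : normedModType R) (g : X -> Y) : Prop :=
  linear g /\ forall x y : X, `|g x - g y| = `|x - y|.

Definition phase_equivalent_to_linear_isometry
    (R : realType) (X Y : normedModType R) (f : X -> Y) : Prop :=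
  exists eps : X -> R,
    (forall x, eps x = -1 \/ eps x = 1) /\
    linear_isometry (fun x => eps x *: f x).

Definition birkhoff_orthogonal (R : realType) (X : normedModType R) (x y : X) : Prop :=
  forall t : R, `|x + t *: y| >= `|x|.

(* Codimension one: the quotient X / Z is spanned by the class of a single
   vector v, and that class is nonzero. Z is not assumed to be closed. *)
Definition hyperplane (R : realType) (X : normedModType R) (Z : set X) : Prop :=
  submod_closed (mem Z) /\
  exists v : X, ~ Z v /\ forall x : X, exists a : R, Z (x - a *: v).

(* Main.v *)
(** On the lines [z + R x0] with [z] in [Z], homogeneity turns the splitting
    hypothesis into [f (z + t x0) = +-(w_t + t f x0)] with [w_t = +-f z].  If
    [w_s <> w_t] with [s, t > 0] then the phase-isometry equation forces
    [|z| <= |s - t|], so [w_t] does not depend on [t > 0].  This picks, for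
    every [x], a value [G x = +-f x] such that [f (x + t x0) = +-(G x + t f x0)]
    for all large [t].  Comparing [x + t x0] with [y + t x0] for [t] so large
    that [|x + y + 2 t x0|] exceeds [|x| + |y|] yields [|G x - G y| = |x - y|],
    so [G] is a surjective isometry fixing 0, hence additive by Mazur-Ulam. *)
Require Import Defs.
From HB Require Import structures.
From mathcomp Require Import all_boot all_order all_algebra.
From mathcomp Require Import all_classical reals topology normedtype.
From mathcomp Require Import lra.

Import Order.TTheory GRing.Theory Num.Theory.
Import numFieldNormedType.Exports.

Local Open Scope classical_set_scope.
Local Open Scope ring_scope.

Set Implicit Arguments.
Unset Strict Implicit.

(** * The Mazur-Ulam theorem for surjective isometries *)

Lemma exp2_gt (R : realType) (C d : R) : 0 < d -> exists n, C < 2 ^+ n * d.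
Proof.
move=> d0; exists (Num.bound `|C / d|).
rewrite -ltr_pdivrMr//; apply: le_lt_trans (ler_norm _) _.
apply: lt_trans (archi_boundP (normr_ge0 _)) _.
by rewrite -natrX ltr_nat ltn_expl.
Qed.

(* Vaisala's argument: conjugating by the point reflection in the midpoint
   doubles the displacement of the midpoint, which is bounded. *)
Lemma midpoint_displacement (R : realType) (X : normedModType R) (a b z : X)
    (n : nat) (g g' : X -> X) :
  z + z = a + b -> cancel g g' -> cancel g' g ->
  (forall x y, `|g x - g y| = `|x - y|) -> g a = a -> g b = b ->
  2 ^+ n * `|g z - z| <= 2 * `|a - z|.
Proof.
move=> zab; elim: n g g' => [|n IHn] g g' gK g'K gI ga gb.
  rewrite mul1r; apply: le_trans (ler_distD a _ _) _.
  by rewrite -{1}ga gI (distrC z a) mulr_natl mulr2n.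
pose r x := a + b - x.
have rK : cancel r r by move=> x; rewrite /r subKr.
have rI x y : `|r x - r y| = `|x - y|.
  by rewrite /r opprB addrC addrA subrK distrC.
have ra : r a = b by rewrite /r addrAC subrr add0r.
have rb : r b = a by rewrite /r addrK.
have rz : r z = z by rewrite /r -zab addrK.
have g'I x y : `|g' x - g' y| = `|x - y| by rewrite -gI !g'K.
have /= := IHn (r \o g' \o r \o g) (g' \o r \o g \o r).
have -> : `|r (g' (r (g z))) - z| = 2 * `|g z - z|.
  rewrite -[X in _ - X]rz rI -[LHS]gI g'K /r -zab distrC.
  rewrite (_ : g z - (z + z - g z) = (g z - z) *+ 2) ?normrMn ?mulr_natl//.
  by rewrite mulr2n opprB opprD addrA addrACA.
rewrite exprSr -mulrA; apply.
- by move=> x /=; rewrite rK g'K rK gK.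
- by move=> x /=; rewrite g'K rK gK rK.
- by move=> x y /=; rewrite rI g'I rI gI.
- by rewrite ga ra -{1}gb gK rb.
- by rewrite gb rb -{1}ga gK ra.
Qed.

(** Following [T] by the reflection [r'], the inverse [T'] and the reflection [r] gives a
    self-isometry of [X] fixing [a] and [b]. By the displacement bound for every [n] it fixes [z],
    so [T z] is a fixed point of [r']. *)
Lemma mazur_ulam_midpoint (R : realType) (X Y : normedModType R) (T : X -> Y)
    (a b z : X) :
  set_surj [set: X] [set: Y] T -> (forall x y, `|T x - T y| = `|x - y|) ->
  z + z = a + b -> T z + T z = T a + T b.
Proof.
move=> Tsurj TI zab.
have [T' T'K] : {T' : Y -> X & forall y, T (T' y) = y}.
  apply: (choice (P := fun y x => T x = y)) => y.
  by have [x _ <-] := Tsurj y I; exists x.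
have TK : cancel T T'.
  by move=> x; apply/eqP; rewrite -subr_eq0 -normr_eq0 -TI T'K subrr normr0.
have T'I x y : `|T' x - T' y| = `|x - y| by rewrite -TI !T'K.
pose r x := a + b - x; pose r' y := T a + T b - y.
have rK : cancel r r by move=> x; rewrite /r subKr.
have r'K : cancel r' r' by move=> x; rewrite /r' subKr.
have rI x y : `|r x - r y| = `|x - y|.
  by rewrite /r opprB addrC addrA subrK distrC.
have r'I x y : `|r' x - r' y| = `|x - y|.
  by rewrite /r' opprB addrC addrA subrK distrC.
have rz : r z = z by rewrite /r -zab addrK.
have fixz : r (T' (r' (T z))) = z.
  apply/eqP; rewrite -subr_eq0 -normr_le0 leNgt; apply/negP => d0.
  have [n] := exp2_gt (2 * `|a - z|) d0.
  apply/negP; rewrite -leNgt.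
  apply: (@midpoint_displacement _ _ a b z n (r \o T' \o r' \o T)
            (T' \o r' \o T \o r)) => //=.
  - by move=> x /=; rewrite rK T'K r'K TK.
  - by move=> x /=; rewrite T'K r'K TK rK.
  - by move=> x y; rewrite rI T'I r'I TI.
  - by rewrite /r' addrAC subrr add0r TK /r addrK.
  - by rewrite /r' addrK TK /r addrAC subrr add0r.
have : r' (T z) = T z by rewrite -[LHS]T'K -[T' _]rK fixz rz.
by rewrite /r' => /eqP; rewrite subr_eq => /eqP.
Qed.

Lemma mazur_ulam_additive (R : realType) (X Y : normedModType R) (T : X -> Y) :
  set_surj [set: X] [set: Y] T -> (forall x y, `|T x - T y| = `|x - y|) ->
  T 0 = 0 -> forall x y, T (x + y) = T x + T y.
Proof.
move=> Tsurj TI T0 x y.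
pose m := 2^-1 *: (x + y).
have mE : m + m = x + y.
  by rewrite -mulr2n -scaler_nat scalerA divff ?scale1r ?pnatr_eq0.
rewrite -(mazur_ulam_midpoint Tsurj TI mE).
(* The pairs [x, y] and [x + y, 0] have the same midpoint [m]. *)
by rewrite -[LHS]addr0 -T0 (mazur_ulam_midpoint (a := x + y) (b := 0) (z := m))// addr0.
Qed.

(** * Sign ambiguity and elementary consequences of the phase-isometry equation *)

Lemma set2_eq (T : Type) (a b c d : T) :
  [set a; b] = [set c; d] -> (a = c /\ b = d) \/ (a = d /\ b = c).
Proof.
move=> E.
have : [set c; d] a by rewrite -E; left.
have : [set c; d] b by rewrite -E; right.
have : [set a; b] c by rewrite E; left.
have : [set a; b] d by rewrite E; right.
by move=> [] ? [] ? [] ? [] ?; subst; auto.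
Qed.

Definition eq_up_to_sign (V : zmodType) (a b : V) := a = b \/ a = - b.

Lemma eq_up_to_sign_sym (V : zmodType) (a b : V) :
  eq_up_to_sign a b -> eq_up_to_sign b a.
Proof. by move=> [->|->]; [left|right; rewrite opprK]. Qed.

Lemma eq_up_to_sign_trans (V : zmodType) (a b c : V) :
  eq_up_to_sign a b -> eq_up_to_sign b c -> eq_up_to_sign a c.
Proof.
by move=> [->|->] [->|->]; rewrite ?opprK; [left|right|right|left].
Qed.

Lemma eq_up_to_signZ (R : pzRingType) (V : lmodType R) (t : R) (a b : V) :
  eq_up_to_sign a b -> eq_up_to_sign (t *: a) (t *: b).
Proof. by move=> [->|->]; rewrite ?scalerN; [left|right]. Qed.

Lemma eq_up_to_sign_norm (R : realType) (V : normedModType R) (a b : V) :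
  eq_up_to_sign a b -> `|a| = `|b|.
Proof. by move=> [->|->]; rewrite ?normrN. Qed.

Lemma norm1_scale (R : realType) (V : normedModType R) (a : R) (v : V) :
  `|a| = 1 -> eq_up_to_sign (a *: v) v.
Proof.
have [a0|a0] := leP 0 a.
  by rewrite ger0_norm// => ->; left; rewrite scale1r.
by rewrite ltr0_norm// => a1; right; rewrite -[a]opprK a1 scaleN1r.
Qed.

(** Negating one of two vectors merely swaps the norms of their sum and difference, so signs may be
    chosen freely. *)
Lemma phase_isometry_signs (R : realType) (X Y : normedModType R) (f : X -> Y)
    (x y : X) (u v : Y) :
  phase_isometry f -> eq_up_to_sign (f x) u -> eq_up_to_sign (f y) v ->
  (`|u + v| = `|x + y| /\ `|u - v| = `|x - y|) \/
  (`|u + v| = `|x - y| /\ `|u - v| = `|x + y|).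
Proof.
move=> fP fu fv; have := set2_eq (fP x y).
case: fu fv => [->|->] [->|->]; rewrite ?opprK //.
- by tauto.
- by rewrite -(normrN (- u + v)) -(normrN (- u - v)) !opprD !opprK; tauto.
- by rewrite -(normrN (- u - v)) -(normrN (- u + v)) !opprD !opprK.
Qed.

Lemma phase_isometry_norm (R : realType) (X Y : normedModType R) (f : X -> Y) :
  phase_isometry f -> forall x, `|f x| = `|x|.
Proof.
move=> fP x; have := set2_eq (fP x x).
rewrite !subrr !normr0 -!mulr2n !normrMn.
case=> -[]; first by move=> /eqP; rewrite eqr_pMn2r// => /eqP.
by move=> /eqP; rewrite mulrn_eq0 => /eqP -> /esym/eqP; rewrite mulrn_eq0 => /eqP ->.
Qed.

Lemma phase_isometryN (R : realType) (X Y : normedModType R) (f : X -> Y) :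
  phase_isometry f -> forall x, eq_up_to_sign (f (- x)) (f x).
Proof.
move=> fP x; have := set2_eq (fP (- x) x).
rewrite addNr normr0; case=> [[+ _]|[_ +]] => /normr0_eq0/eqP.
  by rewrite addr_eq0 => /eqP ->; right.
by rewrite subr_eq0 => /eqP ->; left.
Qed.

(** Positive scalars are handled by normalising [x] and using homogeneity twice, negative ones by
    oddness up to sign. *)
Lemma phase_isometryZ (R : realType) (X Y : normedModType R) (f : X -> Y) :
  phase_isometry f ->
  (forall (x : X) (t : R), `|x| = 1 -> 0 < t ->
     eq_up_to_sign (f (t *: x)) (t *: f x)) ->
  forall (t : R) (x : X), eq_up_to_sign (f (t *: x)) (t *: f x).
Proof.
move=> fP fZ.
have f0 : f 0 = 0 by apply: normr0_eq0; rewrite phase_isometry_norm// normr0.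
have pos (t : R) (x : X) : 0 < t -> eq_up_to_sign (f (t *: x)) (t *: f x).
  move=> t0; have [->|x0] := eqVneq x 0.
    by left; rewrite f0 !scaler0 f0.
  have nx : 0 < `|x| by rewrite normr_gt0.
  pose u := `|x|^-1 *: x.
  have u1 : `|u| = 1 by rewrite normrZ gtr0_norm ?invr_gt0// mulVf ?gt_eqF.
  have xE : x = `|x| *: u by rewrite scalerA divff ?scale1r ?gt_eqF.
  rewrite {1}xE scalerA; apply: eq_up_to_sign_trans.
    by apply: fZ => //; rewrite mulr_gt0.
  rewrite -scalerA; apply/eq_up_to_signZ/eq_up_to_sign_sym.
  by rewrite {1}xE; apply: fZ.
move=> t x; have [t0|t0|->] := ltgtP t 0; last by left; rewrite !scale0r.
  rewrite -[t *: x]opprK -scaleNr.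
  apply: eq_up_to_sign_trans (phase_isometryN fP _) _.
  have [|->|->] := pos (- t) x; first by rewrite oppr_gt0.
    by right; rewrite scaleNr.
  by left; rewrite scaleNr opprK.
exact: pos.
Qed.

(** * Propagation of signs along lines in the direction [x0] *)

Lemma phase_isometry_line (R : realType) (X Y : normedModType R) (f : X -> Y)
    (x0 z : X) (w : Y) :
  phase_isometry f -> `|x0| = 1 -> `|w| = `|z| ->
  (forall t : R, 0 < t ->
     eq_up_to_sign (f (z + t *: x0)) (w + t *: f x0) \/
     eq_up_to_sign (f (z + t *: x0)) (- w + t *: f x0)) ->
  forall s t : R, 0 < s -> 0 < t ->
  eq_up_to_sign (f (z + s *: x0)) (w + s *: f x0) ->
  eq_up_to_sign (f (z + t *: x0)) (w + t *: f x0).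
Proof.
move=> fP x01 wz alt.
have [z0|z0] := eqVneq z 0.
  have w0 : w = 0 by apply: normr0_eq0; rewrite wz z0 normr0.
  by move=> s t _ t0 _; case: (alt t t0) => //; rewrite w0 oppr0.
have p1 : `|f x0| = 1 by rewrite phase_isometry_norm.
(* With opposite signs of [w], the sum of the values has norm [s + t], which is not [|s - t|]. Hence
   the difference [w + w + (s - t) *: f x0] has norm [|s - t|], and the triangle inequality gives
   [|z| <= |s - t|]. *)
have near (s t : R) : 0 < s -> 0 < t -> `|s - t| < `|z| ->
    eq_up_to_sign (f (z + s *: x0)) (w + s *: f x0) ->
    eq_up_to_sign (f (z + t *: x0)) (w + t *: f x0).
  move=> s0 t0 st fs; case: (alt t t0) => // ft.
  have := phase_isometry_signs fP fs ft.
  rewrite (addrACA w) subrr add0r -scalerDl.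
  have -> : w + s *: f x0 - (- w + t *: f x0) = w + w + (s - t) *: f x0.
    by rewrite opprD opprK addrACA -scalerBl.
  have -> : z + s *: x0 - (z + t *: x0) = (s - t) *: x0.
    by rewrite opprD addrACA subrr add0r -scalerBl.
  rewrite !normrZ x01 p1 !mulr1.
  have stp : `|s + t| <> `|s - t|.
    rewrite gtr0_norm ?addr_gt0//; apply/eqP.
    by rewrite gt_eqF// ltr_norml; apply/andP; split; lra.
  case=> [[_ E]|[]//].
  have : `|w + w + (s - t) *: f x0 - (s - t) *: f x0| <= `|s - t| + `|s - t|.
    by apply: le_trans (ler_normB _ _) _; rewrite E normrZ p1 mulr1.
  by rewrite addrK -!mulr2n normrMn wz ler_pMn2r// leNgt st.
(* Bisection reduces any distance to the range of [near]; midpoints of positive parameters stay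
   positive. *)
have far n (s t : R) : 0 < s -> 0 < t -> `|s - t| < 2 ^+ n * `|z| ->
    eq_up_to_sign (f (z + s *: x0)) (w + s *: f x0) ->
    eq_up_to_sign (f (z + t *: x0)) (w + t *: f x0).
  elim: n s t => [|n IHn] s t s0 t0; first by rewrite mul1r; apply: near.
  rewrite exprS -mulrA => st fs.
  have m0 : 0 < (s + t) / 2 by lra.
  have h (a : R) : `|a| = 2 * `|a / 2|.
    by rewrite normrM [`|2^-1|]gtr0_norm ?invr_gt0//; lra.
  rewrite h ltr_pM2l// in st.
  have ms : s - (s + t) / 2 = (s - t) / 2 by lra.
  have mt : (s + t) / 2 - t = (s - t) / 2 by lra.
  apply: (IHn ((s + t) / 2)); rewrite ?mt//.
  by apply: (IHn s); rewrite ?ms.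
move=> s t s0 t0; have nz : 0 < `|z| by rewrite normr_gt0.
by have [n] := exp2_gt `|s - t| nz; exact: far.
Qed.

(* [y] is the value of [f] at [x] with the sign fixed by the behaviour of [f]
   far out in the direction [x0]. *)
Definition far_lift (R : realType) (X Y : normedModType R) (f : X -> Y)
    (x0 x : X) (y : Y) :=
  exists T : R, forall t, T < t ->
    eq_up_to_sign (f (x + t *: x0)) (y + t *: f x0).

Lemma far_lift_isometry (R : realType) (X Y : normedModType R) (f : X -> Y)
    (x0 x x' : X) (y y' : Y) :
  phase_isometry f -> `|x0| = 1 ->
  far_lift f x0 x y -> far_lift f x0 x' y' -> `|y - y'| = `|x - x'|.
Proof.
move=> fP x01 [T xy] [T' xy'].
(* This [t] passes both thresholds and makes [2 * t] exceed [|y - y'| + |x + x'|], which rules out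
   the crossed matching of norms. *)
pose t := `|T| + `|T'| + `|y - y'| + `|x + x'| + 1.
have [Tt T't] : T < t /\ T' < t.
  have := (ler_norm T, ler_norm T').
  have := (normr_ge0 T, normr_ge0 T', normr_ge0 (y - y'), normr_ge0 (x + x')).
  by rewrite /t => -[[[? ?] ?] ?] [? ?]; lra.
have := phase_isometry_signs fP (xy t Tt) (xy' t T't).
have cancelB (V : normedModType R) (a b c : V) : a + c - (b + c) = a - b.
  by rewrite opprD addrACA subrr addr0.
rewrite !cancelB => -[[]//|[_ E]]; exfalso.
have : `|t *: x0 + t *: x0| <= `|y - y'| + `|x + x'|.
  have -> : t *: x0 + t *: x0 = (x + t *: x0 + (x' + t *: x0)) - (x + x').
    by rewrite [X in X - _]addrACA [x + x' + _]addrC addrK.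
  by rewrite E ler_normB.
rewrite -scalerDl normrZ x01 mulr1.
have := (ler_norm (t + t), normr_ge0 T, normr_ge0 T').
have := (normr_ge0 (y - y'), normr_ge0 (x + x')).
by rewrite /t => -[? ?] [[? ?] ?]; lra.
Qed.

(** Modulo [Z], [x0] is a nonzero multiple of [v], so it can replace [v] as a spanning vector. *)
Lemma hyperplane_complement (R : realType) (X : normedModType R) (Z : set X)
    (x0 : X) :
  hyperplane Z -> ~ Z x0 -> forall x, exists2 z, Z z & exists c, x = z + c *: x0.
Proof.
move=> [[Z0 Zlin] [v [_ vZ]]] x0Z x.
have lin (a : R) u u' : Z u -> Z u' -> Z (a *: u + u').
  by move=> Zu Zu'; apply/set_mem/Zlin; apply/mem_set.
have [a Za] := vZ x0; have [b Zb] := vZ x.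
have a0 : a != 0.
  by apply/eqP => a0; apply: x0Z; rewrite -[x0]subr0 -(scale0r v) -a0.
exists (x - (b / a) *: x0); last by exists (b / a); rewrite subrK.
have -> : x - (b / a) *: x0 = (- (b / a)) *: (x0 - a *: v) + (x - b *: v).
  rewrite scalerBr scalerA mulNr divfK// !scaleNr opprK.
  by rewrite addrACA subrr addr0 addrC.
exact: lin.
Qed.

(** For [x = z + c *: x0] the lift is [w + c *: f x0], where [w] is the value [f z] with the sign
    that persists along the ray [z + t *: x0], [t > 0]. *)
Lemma far_lift_exists (R : realType) (X Y : normedModType R) (f : X -> Y)
    (x0 : X) (Z : set X) :
  phase_isometry f ->
  (forall (t : R) x, eq_up_to_sign (f (t *: x)) (t *: f x)) ->
  `|x0| = 1 -> hyperplane Z -> ~ Z x0 ->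
  (forall z, Z z -> exists alpha beta : R,
     [/\ `|alpha| = 1, `|beta| = 1 &
         f (z + x0) = alpha *: f z + beta *: f x0]) ->
  forall x, exists y, eq_up_to_sign (f x) y /\ far_lift f x0 x y.
Proof.
move=> fP fZ x01 hZ x0Z split.
have ZN z : Z z -> Z (- z).
  case: hZ => -[Z0 Zlin] _ Zz; rewrite -scaleN1r -[_ *: _]addr0.
  by apply/set_mem/Zlin => //; apply/mem_set.
have Zscale (t : R) z : Z z -> Z (t *: z).
  case: hZ => -[Z0 Zlin] _ Zz; rewrite -[_ *: _]addr0.
  by apply/set_mem/Zlin => //; apply/mem_set.
have alt1 z : Z z -> eq_up_to_sign (f (z + x0)) (f z + f x0) \/
                     eq_up_to_sign (f (z + x0)) (- f z + f x0).
  move=> /split[a [b [a1 b1 ->]]].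
  case: (norm1_scale (f z) a1) => ->;
    case: (norm1_scale (f x0) b1) => ->.
  - by left; left.
  - by right; right; rewrite opprD opprK.
  - by right; left.
  - by left; right; rewrite opprD.
have alt z (t : R) : Z z -> 0 < t ->
    eq_up_to_sign (f (z + t *: x0)) (f z + t *: f x0) \/
    eq_up_to_sign (f (z + t *: x0)) (- f z + t *: f x0).
  (* Since [z + t *: x0 = t *: (u + x0)], homogeneity reduces the claim to the splitting at [u]. *)
  move=> Zz t0; pose u := t^-1 *: z.
  have zE : z = t *: u by rewrite scalerA divff ?scale1r ?gt_eqF.
  have fu : eq_up_to_sign (f z) (t *: f u) by rewrite {1}zE.
  have fzt : eq_up_to_sign (f (z + t *: x0)) (t *: f (u + x0)).
    by rewrite zE -scalerDr.
  have [] := alt1 u (Zscale _ _ Zz) => /(eq_up_to_signZ t);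
    rewrite scalerDr ?scalerN => /(eq_up_to_sign_trans fzt);
    by case: fu => ->; rewrite ?opprK; auto.
have lift z : Z z -> exists2 w, eq_up_to_sign (f z) w & forall t : R, 0 < t ->
    eq_up_to_sign (f (z + t *: x0)) (w + t *: f x0).
  move=> Zz.
  have fz : `|f z| = `|z| by exact: phase_isometry_norm.
  (* The sign seen at parameter 1 is the one carried to every [t > 0]. *)
  case: (alt z 1 Zz ltr01) => f1; [exists (f z); first by left | exists (- f z)].
  - by move=> t t0; apply: (phase_isometry_line fP x01 _ _ (s := 1)) f1 => // s; exact: alt.
  - by right; rewrite opprK.
  - move=> t t0; apply: (phase_isometry_line fP x01 _ _ (s := 1)) f1 => //; first by rewrite normrN.
    by move=> s s0; rewrite opprK; have [] := alt z s Zz s0; auto.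
move=> x; have [z Zz [c ->]] := hyperplane_complement hZ x0Z x.
have [w fw wt] := lift z Zz.
exists (w + c *: f x0); split; last first.
  exists (- c) => t ct; rewrite -!addrA -!scalerDl; apply: wt; lra.
have [c0|c0|->] := ltgtP c 0; last 2 first.
- exact: wt.
- by rewrite !scale0r !addr0.
(* For [c < 0] the point [- x] lies on the positive ray from [- z]. The signs chosen at [z] and
   [- z] are opposite: [w' = w] would give [|z + z| = 0], since lifts preserve distances. *)
have [w' fw' wt'] := lift (- z) (ZN _ Zz).
have w'E : w' = - w.
  have : eq_up_to_sign w' w.
    apply: eq_up_to_sign_trans (eq_up_to_sign_sym fw') _.
    exact: eq_up_to_sign_trans (phase_isometryN fP _) fw.
  case=> // ww'.
  have : `|w - w'| = `|z - - z|.
    by apply: far_lift_isometry fP x01 _ _; exists 0.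
  rewrite ww' subrr normr0 opprK -mulr2n normrMn => /esym/eqP.
  rewrite mulrn_eq0/= -(phase_isometry_norm fP) (eq_up_to_sign_norm fw).
  by rewrite normr_eq0 => /eqP ->; rewrite oppr0.
rewrite -[z + _]opprK; apply: eq_up_to_sign_trans (phase_isometryN fP _) _.
rewrite opprD -scaleNr; have := wt' (- c); rewrite oppr_gt0 => /(_ c0).
rewrite w'E => /eq_up_to_sign_trans; apply.
by right; rewrite opprD scaleNr.
Qed.

Unset Implicit Arguments.

Theorem proposition3p2 (R : realType) (X Y : normedModType R) (f : X -> Y)
  (f_surj : set_surj [set: X] [set: Y] f)
  (f_phase : phase_isometry f)
  (f_homog : forall (x : X) (t : R), `|x| = 1 -> 0 < t ->
     f (t *: x) = t *: f x \/ f (t *: x) = - (t *: f x))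
  (f_split : exists (x0 : X) (Z : set X),
     [/\ `|x0| = 1,
         hyperplane Z,
         (forall z, Z z -> birkhoff_orthogonal x0 z),
         (forall z, Z z -> birkhoff_orthogonal z x0) &
         forall z, Z z -> exists alpha beta : R,
           [/\ `|alpha| = 1, `|beta| = 1 &
               f (z + x0) = alpha *: f z + beta *: f x0]]) :
  phase_equivalent_to_linear_isometry f.
Proof.
have [x0 [Z [x01 hZ x0Z _ split]]] := f_split.
have nZx0 : ~ Z x0.
  (* Orthogonality of [x0] to itself fails at scalar -1, where it would give [1 <= 0]. *)
  by move=> /x0Z /(_ (- 1)); rewrite scaleN1r subrr normr0 x01 ler10.
have fZ := phase_isometryZ f_phase f_homog.
have [G GP] := choice (far_lift_exists f_phase fZ x01 hZ nZx0 split).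
have fG x : eq_up_to_sign (f x) (G x) by have [] := GP x.
have GI x y : `|G x - G y| = `|x - y|.
  have [_ Gx] := GP x; have [_ Gy] := GP y.
  exact: far_lift_isometry f_phase x01 Gx Gy.
have Gnorm x : `|G x| = `|x|.
  by rewrite -(eq_up_to_sign_norm (fG x)) phase_isometry_norm.
have G0 : G 0 = 0 by apply: normr0_eq0; rewrite Gnorm normr0.
have GZ (t : R) x : G (t *: x) = t *: G x.
  have : eq_up_to_sign (G (t *: x)) (t *: G x).
    apply: eq_up_to_sign_trans (eq_up_to_sign_sym (fG _)) _.
    exact: eq_up_to_sign_trans (fZ t x) (eq_up_to_signZ t (fG x)).
  (* If [G (t *: x) = - (t *: G x)], comparing distances to [x] gives
     [|t + 1| * |x| = |t - 1| * |x|], so [t = 0] or [x = 0]. *)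
  case=> // E; have [->|t0] := eqVneq t 0; first by rewrite !scale0r.
  have := GI (t *: x) x.
  have -> : t *: x - x = (t - 1) *: x by rewrite scalerBl scale1r.
  have -> : G (t *: x) - G x = - (t + 1) *: G x.
    by rewrite E scaleNr scalerDl scale1r opprD.
  rewrite !normrZ Gnorm normrN => /eqP; rewrite -subr_eq0 -mulrBl mulf_eq0.
  rewrite normr_eq0 => /orP[|/eqP ->]; last by rewrite scaler0 G0 scaler0.
  rewrite subr_eq0 eqr_norm2 => /orP[] /eqP tE.
    by exfalso; lra.
  by case/eqP: t0; lra.
have GN x : G (- x) = - G x by rewrite -scaleN1r GZ scaleN1r.
have Gsurj : set_surj [set: X] [set: Y] G.
  move=> y _; have [x _ <-] := f_surj y I.
  (* When [f x = - G x], oddness of [G] makes [- x] a preimage of [f x]. *)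
  by case: (fG x) => ->; [exists x | exists (- x)].
exists (fun x => if `[< f x = G x >] then 1 else -1); split.
  by move=> x; case: ifP; auto.
have -> : (fun x => (if `[< f x = G x >] then 1 else -1) *: f x) = G.
  apply/funext => x; case: asboolP => [->|]; first by rewrite scale1r.
  by case: (fG x) => // -> _; rewrite scaleN1r opprK.
split=> // a u v.
by rewrite (mazur_ulam_additive Gsurj)// GZ.
Qed.
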